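(* Let $p,n\ge 1$ be integers. The number of similarity classes of indecomposable triples $(V,T,U)$ with $o(T)=p$, $n_V=n$ and $n_U=1$ is the binomial coefficient $\binom{p}{2n-1}$.
   Context: All vector spaces are finite-dimensional over $\mathbb{C}$. A triple $(V,T,U)$ consists of a vector space $V$, a nilpotent linear operator $T$ on $V$, and a subspace $U\subset V$ with $T(U)\subset U$. The order of nilpotency is $o(T)=p\ge 1$ with $T^p=0$ and $T^{p-1}\neq 0$. For an invariant subspace $W$ of $T$ put $[W]=\ker(T|_W)$ and $n_W=\dim [W]$ (in particular $n_V=\dim\ker T$). The triple $(V,T,U)$ is indecomposable if for all $T$-invariant subspaces $V',V''$ with $V=V'\oplus V''$ and $U=(U\cap V')\oplus(U\cap V'')$ one has $V'=\{0\}$ or $V''=\{0\}$. Two triples $(V,T,U)$ and $(V',T',U')$ are similar if there is an invertible linear map $f:V\to V'$ with $f(U)=U'$ and $fT=T'f$. Binomial coefficients $\binom{p}{m}$ with $m>p$ are $0$. *)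

(* Defs.v *)
From HB Require Import structures.
From mathcomp Require Import all_boot all_order all_algebra.
From mathcomp Require Import reals.
From mathcomp.real_closed Require Import complex.

Set Implicit Arguments.
Unset Strict Implicit.
Unset Printing Implicit Defensive.

Import GRing.Theory.
Local Open Scope ring_scope.

(* The `#=` of mathcomp-analysis cannot be used on collections of triples:    *)
(* the universe of `set` lies strictly below that of `vectType`.              *)
Definition has_card (T : Type) (A : T -> Prop) (N : nat) : Prop :=
  exists2 c : 'I_N -> T, injective c & forall x, A x <-> exists i, c i = x.

Section Triples.
Variable K : fieldType.

(* 'End(V) carries its ring structure only when V is a nonzero space, so the  *)
(* powers of an operator are defined by iterated composition.                 *)
Definition lfun_exp (V : vectType K) (T : 'End(V)) (k : nat) : 'End(V) :=
  iter k (comp_lfun T) \1%VF.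

Record triple := Triple {
  space : vectType K;
  oper : 'End(space);
  subsp : {vspace space};
  oper_nilpotent : exists k, lfun_exp oper k = 0;
  subsp_invariant : (oper @: subsp <= subsp)%VS
}.

Definition nilpotency_order (V : vectType K) (T : 'End(V)) (p : nat) : Prop :=
  [/\ (1 <= p)%N, lfun_exp T p = 0 & lfun_exp T p.-1 <> 0].

Definition ker_restr (V : vectType K) (T : 'End(V)) (W : {vspace V}) :
  {vspace V} := (W :&: lker T)%VS.

Definition nker (V : vectType K) (T : 'End(V)) (W : {vspace V}) : nat :=
  \dim (ker_restr T W).

Definition indecomposable (X : triple) : Prop :=
  forall V1 V2 : {vspace space X},
    (oper X @: V1 <= V1)%VS -> (oper X @: V2 <= V2)%VS ->
    directv (V1 + V2) -> fullv = (V1 + V2)%VS ->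
    directv ((subsp X :&: V1) + (subsp X :&: V2)) ->
    subsp X = ((subsp X :&: V1) + (subsp X :&: V2))%VS ->
    V1 = 0%VS \/ V2 = 0%VS.

Definition tsimilar (X Y : triple) : Prop :=
  exists f : 'Hom(space X, space Y),
    [/\ bijective f, (f @: subsp X)%VS = subsp Y &
        (f \o oper X)%VF = (oper Y \o f)%VF].

Definition admissible (p n : nat) (X : triple) : Prop :=
  [/\ indecomposable X,
      nilpotency_order (oper X) p,
      nker (oper X) fullv = n &
      nker (oper X) (subsp X) = 1%N].

(* A similarity class is the predicate `tsimilar X` of triples similar to X.  *)
Definition similarity_class (p n : nat) (C : triple -> Prop) : Prop :=
  exists2 X : triple, admissible p n X & C = tsimilar X.

End Triples.

Arguments similarity_class K p n C : clear implicits.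

(* Main.v *)
Require Import Defs.
From HB Require Import structures.
From mathcomp Require Import all_boot all_order all_algebra.
From mathcomp Require Import zify ring boolp reals.
From mathcomp.real_closed Require Import complex.

Set Implicit Arguments.
Unset Strict Implicit.
Unset Printing Implicit Defensive.

Import GRing.Theory.
Local Open Scope ring_scope.

(** A nilpotent operator [T] makes [V] a module over [K[X]] on which a power of
    [X] acts as zero, and [U] is a submodule.  Such modules are direct sums of
    cyclic ones, [K[X]/(X^(lam i))] with generators [e i]
    ([jordan_presentation]).  The kernel of [T] has one dimension per cyclic
    summand ([nker_presents]), so [n_U = 1] says that [U] is generated by one
    vector [u], and [n_V = n] that there are [n] summands.

    Write [u] as the sum of the [g i e i].  If the triple is indecomposable, no
    [g i e i] is zero, for otherwise the summand of [e i] splits off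
    ([component_neq0]).  So [g i] is [X^(a i)] times a unit modulo
    [X^(lam i)], and the unit can be absorbed into [e i].  Put
    [b i = lam i - a i > 0], the order of the [i]-th component of [u].  If
    [a i <= a j] and [b j <= b i] for some [i <> j], then
    [e i + X^(a j - a i) e j] is a generator of the same order as [e i], and
    relative to it [u] has no component along [e j], a contradiction
    ([marked_comonotone]).  So the pairs [(a i, b i)] form a chain that is
    strictly increasing in both coordinates, and they determine the triple up
    to similarity ([normal_form_similar]).

    Conversely a triple given by such a chain is indecomposable
    ([normal_form_indecomposable]): its block sizes are distinct, and each block
    is detected by a vector of [U], so no block fits in a complement of a summand
    containing [U].  The chain is recovered from the triple, because it is the
    set of corners of the region of all [(k, j)] for which [T^k U] is not
    contained in [T^(k + j) V] ([marked_height], [comonotone_corner]).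

    It remains to count the chains.  Order the pairs decreasingly, from
    [(a 0, b 0)] to [(a (n-1), b (n-1))]; then [o(T) = p] says that
    [a 0 + b 0 = p].  The chain amounts to the increasing sequence
    [a (n-1) < ... < a 0 = p - b 0 < p - b 1 < ... < p - b (n-1)] in
    [{0, ..., p-1}], that is, to a subset with [2n - 1] elements. *)

(** * Divisibility by powers of the variable *)

Section PowersOfX.
Variable K : fieldType.
Implicit Types (g h : {poly K}) (d l : nat).

Lemma dvdXnP l g :
  reflect (forall k, (k < l)%N -> g`_k = 0) ('X^l %| g).
Proof.
apply: (iffP idP) => [/dvdpP[q ->] k kl | g0]; first by rewrite coefMXn kl.
suff -> : g = drop_poly l g * 'X^l by exact: dvdp_mull.
rewrite -[LHS](poly_take_drop l) -[RHS]add0r; congr (_ + _).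
by apply/polyP => k; rewrite coef_take_poly coef0; case: ifP => // /g0.
Qed.

Lemma dvdXnXn d l : ('X^l %| ('X^d : {poly K})) = (l <= d)%N.
Proof.
apply/idP/idP => [/dvdXnP/(_ d) | /dvdp_exp2l->//].
rewrite coefXn eqxx leqNgt; case: ltnP => // _ /(_ isT) /eqP.
by rewrite oner_eq0.
Qed.

Lemma dvdXn_mulXn d l g : ('X^l %| 'X^d * g) = ('X^(l - d) %| g).
Proof.
apply/dvdXnP/dvdXnP => g0 k kl.
  by have := g0 (k + d)%N; rewrite coefXnM addnK ifF; [apply; lia | lia].
by rewrite coefXnM; case: ltnP => // dk; apply: g0; lia.
Qed.

Lemma dvdXn_mul_const d l (c : K) :
  (d < l)%N -> 'X^l %| c *: 'X^d -> c = 0.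
Proof. by move=> dl /dvdXnP/(_ d dl); rewrite coefZ coefXn eqxx mulr1. Qed.

Lemma coprimep_Xn l h : h`_0 != 0 -> coprimep 'X^l h.
Proof.
by move=> h0; rewrite coprimep_expl // coprimep_sym coprimepX /root horner_coef0.
Qed.

Lemma inverse_mod_Xn l h : h`_0 != 0 -> exists r, 'X^l %| r * h - 1.
Proof.
move=> /(coprimep_Xn l)/Bezout_eq1_coprimepP[[u v] /= uv1]; exists v.
by rewrite -uv1 opprD addrCA subrr addr0 -mulNr dvdp_mull.
Qed.

Lemma valuation_factor l g :
  ~~ ('X^l %| g) -> exists d h, [/\ (d < l)%N, g = 'X^d * h & h`_0 != 0].
Proof.
move=> lg; have exk : exists k, g`_k != 0.
  apply: contrapT => no; case/negP: lg; apply/dvdXnP => k _; apply/eqP.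
  by apply: contrapT => gk; apply: no; exists k; apply/negP.
case: (ex_minnP exk) => d gd dmin; exists d, (drop_poly d g).
rewrite coef_drop_poly add0n; split=> //.
  by apply: contraNT lg; rewrite -leqNgt => ld; apply/dvdXnP => k kl;
     apply/eqP; apply: contraNT gd => /dmin; lia.
rewrite mulrC -[LHS](poly_take_drop d) -[RHS]add0r; congr (_ + _).
apply/polyP => k; rewrite coef_take_poly coef0; case: ltnP => // kd.
by apply/eqP; apply: contraTT kd => /dmin; rewrite -leqNgt.
Qed.

End PowersOfX.

(** * Operators as modules over the polynomial ring *)

Section Action.
Variables (K : fieldType) (V : vectType K) (T : 'End(V)).
Implicit Types (g h : {poly K}) (v w : V) (W : {vspace V}).

(** The operator [g(T)].  It is a sum of iterates, not a value of the
    polynomial [g] in a ring of operators, since ['End(V)] is a nonzero ring only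
    when [V] is a nonzero space. *)
Definition pact g : 'End(V) := \sum_(k < size g) g`_k *: lfun_exp T k.

Lemma pact_widen n g :
  (size g <= n)%N -> pact g = \sum_(k < n) g`_k *: lfun_exp T k.
Proof.
move=> gn; rewrite /pact (big_ord_widen n (fun k => g`_k *: lfun_exp T k)) //.
rewrite big_mkcond; apply: eq_bigr => k _; case: ltnP => // /(nth_default 0) ->.
by rewrite scale0r.
Qed.

Fact pact_is_linear : linear pact.
Proof.
move=> c g h; pose n := maxn (size (c *: g + h)) (maxn (size g) (size h)).
rewrite !(@pact_widen n) ?leq_max ?leqnn ?orbT //.
rewrite scaler_sumr -big_split /=; apply: eq_bigr => k _.
by rewrite coefD coefZ scalerDl scalerA.
Qed.
HB.instance Definition _ := GRing.isLinear.Build K {poly K} 'End(V) _ pact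
  pact_is_linear.

Lemma pact1 v : pact 1 v = v.
Proof.
by rewrite /pact size_poly1 big_ord1 coef1 eqxx scale1r /= lfunE.
Qed.


Lemma pactZ c g v : pact (c *: g) v = c *: pact g v.
Proof. by rewrite linearZ /= scale_lfunE. Qed.

Lemma pactD g h v : pact (g + h) v = pact g v + pact h v.
Proof. by rewrite linearD /= add_lfunE. Qed.

Lemma pactB g h v : pact (g - h) v = pact g v - pact h v.
Proof. by rewrite linearB /= add_lfunE opp_lfunE. Qed.

Lemma pact0 v : pact 0 v = 0.
Proof. by rewrite linear0 lfunE. Qed.

Lemma lfun_expS k v : lfun_exp T k.+1 v = T (lfun_exp T k v).
Proof. by rewrite /lfun_exp /= comp_lfunE. Qed.

Lemma pactXn k v : pact 'X^k v = lfun_exp T k v.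
Proof.
rewrite (@pact_widen k.+1) ?size_polyXn // big_ord_recr /= big1 => [|i _].
  by rewrite add0r coefXn eqxx scale1r.
by rewrite coefXn (ltn_eqF (ltn_ord i)) scale0r.
Qed.

Lemma pactX v : pact 'X v = T v.
Proof. by rewrite -['X]expr1 pactXn lfun_expS /= lfunE. Qed.

Lemma pactMX g v : pact (g * 'X) v = T (pact g v).
Proof.
rewrite (@pact_widen (size g).+1); last first.
  by have [->|g0] := eqVneq g 0; rewrite ?mul0r ?size_poly0 // size_mulX.
rewrite big_ord_recl coefMX eqxx scale0r add0r /pact !sum_lfunE linear_sum.
by apply: eq_bigr => k _; rewrite coefMX /= !scale_lfunE linearZ /= -lfun_expS.
Qed.

Lemma pactM g h v : pact (g * h) v = pact g (pact h v).
Proof.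
elim/poly_ind: g v => [|g c IH] v; first by rewrite mul0r !pact0.
rewrite mulrDl !pactD; congr (_ + _); last first.
  by rewrite mul_polyC -alg_polyC !pactZ pact1.
by rewrite mulrAC !pactMX IH.
Qed.

Definition invariant W := (T @: W <= W)%VS.

Lemma invariantP W :
  reflect (forall v, v \in W -> T v \in W) (invariant W).
Proof.
apply: (iffP subvP) => WT v; last by move=> /memv_imgP[u uW ->]; exact: WT.
by move=> vW; apply/WT/memv_img.
Qed.

Lemma pact_stable W g v : invariant W -> v \in W -> pact g v \in W.
Proof.
move=> /invariantP WT vW; rewrite /pact sum_lfunE; apply: memv_suml => k _.
rewrite scale_lfunE; apply: memvZ; elim: (k : nat) => [|j IH] /=.
  by rewrite lfunE.
by rewrite comp_lfunE; exact: WT.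
Qed.

End Action.

Lemma pact_intertwine (K : fieldType) (V V' : vectType K) (T : 'End(V))
    (T' : 'End(V')) (f : 'Hom(V, V')) :
  (f \o T = T' \o f)%VF ->
  forall g v, f (pact T g v) = pact T' g (f v).
Proof.
move=> fT g v; elim/poly_ind: g v => [|g c IH] v; first by rewrite !pact0 linear0.
rewrite !pactD linearD -alg_polyC !pactZ !pact1 linearZ; congr (_ + _).
by have /lfunP/(_ (pact T g v)) := fT; rewrite !comp_lfunE !pactMX -IH.
Qed.
(** * Generators and relations *)

Section Presentations.
Variables (K : fieldType) (V : vectType K) (T : 'End(V)).
Implicit Types (I J : finType) (W : {vspace V}) (v : V).

Definition lincomb I (g : I -> {poly K}) (e : I -> V) : V :=
  \sum_i pact T (g i) (e i).

Definition generates I (e : I -> V) W : Prop :=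
  forall v, v \in W <-> exists g, v = lincomb g e.

(** [generates] together with [free_relations] says that [W] is the direct sum
    of the cyclic modules [K[X]/(X^(lam i))] generated by the [e i]: a Jordan
    basis of [W], with blocks of sizes [lam i]. *)
Definition free_relations I (e : I -> V) (lam : I -> nat) : Prop :=
  forall g, lincomb g e = 0 <-> forall i, 'X^(lam i) %| g i.

Definition presents I (e : I -> V) (lam : I -> nat) W : Prop :=
  generates e W /\ free_relations e lam.

Lemma lincombD I (g h : I -> {poly K}) e :
  lincomb (fun i => g i + h i) e = lincomb g e + lincomb h e.
Proof. by rewrite -big_split; apply: eq_bigr => i _; rewrite pactD. Qed.

Lemma lincombB I (g h : I -> {poly K}) e :
  lincomb (fun i => g i - h i) e = lincomb g e - lincomb h e.
Proof. by rewrite -sumrB; apply: eq_bigr => i _; rewrite pactB. Qed.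

Lemma lincombM I p (g : I -> {poly K}) e :
  lincomb (fun i => p * g i) e = pact T p (lincomb g e).
Proof. by rewrite linear_sum; apply: eq_bigr => i _; rewrite pactM. Qed.

Lemma lincombZ I c (g : I -> {poly K}) e :
  lincomb (fun i => c *: g i) e = c *: lincomb g e.
Proof. by rewrite scaler_sumr; apply: eq_bigr => i _; rewrite pactZ. Qed.

Lemma lincomb_single I i p (e : I -> V) :
  lincomb (fun j => if j == i then p else 0) e = pact T p (e i).
Proof.
rewrite /lincomb (bigD1 i) //= eqxx big1 ?addr0 // => j /negPf->.
by rewrite pact0.
Qed.

Lemma lincomb_stable I W (g : I -> {poly K}) e :
  invariant T W -> (forall i, e i \in W) -> lincomb g e \in W.
Proof. by move=> Winv eW; apply: memv_suml => i _; apply: pact_stable. Qed.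

Lemma generates_mem I (e : I -> V) W i : generates e W -> e i \in W.
Proof.
by move=> eW; apply/eW; eexists; rewrite -[e i](pact1 T) -lincomb_single.
Qed.

Lemma generates_invariant I (e : I -> V) W : generates e W -> invariant T W.
Proof.
move=> eW; apply/invariantP => v /eW[g ->]; apply/eW.
by exists (fun i => 'X * g i); rewrite lincombM pactX.
Qed.


Section Nilpotent.
Variable N : nat.
Hypothesis TN : lfun_exp T N = 0.

(** The iterates beyond [N] vanish, so finitely many lines span the submodule. *)
Definition module_span I (e : I -> V) : {vspace V} :=
  (\sum_(x : I * 'I_N) <[pact T 'X^(x.2) (e x.1)]>)%VS.

Lemma pact_Xn0 d v : (N <= d)%N -> pact T 'X^d v = 0.
Proof.
by move=> /subnKC <-; rewrite exprD pactM pactXn TN lfunE.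
Qed.

Lemma module_spanP I (e : I -> V) : generates e (module_span e).
Proof.
move=> v; split=> [/memv_sumP[vs vsP ->] | [g ->]].
  have {}vsP (x : I * 'I_N) : exists c, vs x = c *: pact T 'X^(x.2) (e x.1).
    by have /vlineP := vsP x isT.
  have [c vsE] := choice vsP.
  exists (fun i => \sum_(k < N) c (i, k) *: 'X^k).
  have -> : \sum_x vs x = \sum_x c (x.1, x.2) *: pact T 'X^(x.2) (e x.1).
    apply: eq_bigr; by case=> i k _; rewrite vsE.
  rewrite -(pair_bigA _ (fun i (k : 'I_N) => c (i, k) *: pact T 'X^k (e i))) /=.
  apply: eq_bigr => i _; rewrite linear_sum sum_lfunE; apply: eq_bigr => k _.
  by rewrite pactZ.
apply: memv_suml => i _.
rewrite (@pact_widen _ _ _ (maxn N (size (g i)))) ?leq_maxr //.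
rewrite sum_lfunE; apply: memv_suml => k _.
rewrite scale_lfunE memvZ // -pactXn; have [kN|Nk] := ltnP k N.
  by apply/(subvP (sumv_sup (i, Ordinal kN) _ (subvv _)))=> //; exact: memv_line.
by rewrite pact_Xn0 ?mem0v.
Qed.

Lemma generates_change I J (e : I -> V) (e' : J -> V) W :
  generates e W -> (forall j, e' j \in W) ->
  (forall i, exists g, e i = lincomb g e') -> generates e' W.
Proof.
move=> eW e'W ee' v; have e'P := module_spanP e'.
split=> [/eW[g ->] | [g ->]]; last first.
  exact: lincomb_stable (generates_invariant eW) e'W.
apply/e'P; apply: lincomb_stable (generates_invariant e'P) _ => i.
exact/e'P/ee'.
Qed.

Lemma presents_lam0 I (e : I -> V) lam i :
  free_relations e lam -> lam i = 0%N -> e i = 0.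
Proof.
move=> rel li; rewrite -[e i](pact1 T) -lincomb_single; apply/rel => j.
by case: eqP => [->|_]; rewrite ?dvdp0 // li dvd1p.
Qed.

Lemma presents_order I (e : I -> V) lam i d :
  free_relations e lam -> pact T 'X^d (e i) = 0 <-> (lam i <= d)%N.
Proof.
move=> rel; rewrite -lincomb_single; split=> [/rel/(_ i)|ld].
  by rewrite eqxx dvdXnXn.
by apply/rel => j; case: eqP => [->|_]; rewrite ?dvdp0 // dvdXnXn.
Qed.

(** Generators of order [0] vanish, so they can be dropped from a presentation,
    and the remaining ones can be renumbered. *)
Lemma presents_reindex I J (h : J -> I) (e : I -> V) lam W :
  injective h -> (forall i, (0 < lam i)%N -> i \in codom h) ->
  presents e lam W -> presents (e \o h) (lam \o h) W.
Proof.
move=> hinj hsurj [eW rel]; split.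
  apply: (generates_change eW) => [j|i].
    exact: (@generates_mem _ e _ (h j) eW).
  have [/(presents_lam0 rel) ->|/hsurj/codomP[j ->]] := posnP (lam i).
    by exists (fun=> 0); rewrite /lincomb big1 // => j _; rewrite pact0.
  by exists (fun k => if k == j then 1 else 0); rewrite lincomb_single pact1.
move=> g; pose g' i := \sum_(j | h j == i) g j.
have g'h j : g' (h j) = g j.
  by apply: big_pred1 => k /=; rewrite (inj_eq hinj).
have -> : lincomb g (e \o h) = lincomb g' e.
  rewrite /lincomb (partition_big h xpredT) //=; apply: eq_bigr => i _.
  by rewrite linear_sum sum_lfunE; apply: eq_bigr => j /eqP <-.
split=> [/rel gd j | gd]; first by have := gd (h j); rewrite g'h.
apply/rel => i; have [->|/hsurj/codomP[j ->]] := posnP (lam i).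
  by rewrite dvd1p.
by rewrite g'h; exact: gd.
Qed.

(** If some relation [lincomb g e = 0] is not a consequence of the relations
    [X^(lam i) e i = 0], discard its zero terms and divide it by the largest
    power [X^d] dividing all the [g i].  The generator [e i0] for which [g i0 / X^d] is a unit can be
    replaced by [lincomb (g / X^d) e], which is killed by [X^d] where
    [d < lam i0].  The sum of the orders decreases, so this terminates. *)
Lemma presentation_exists I (e : I -> V) lam W :
  generates e W -> (forall i, pact T 'X^(lam i) (e i) = 0) ->
  exists (e' : I -> V) lam', presents e' lam' W.
Proof.
have [s] := ubnP (\sum_i lam i)%N.
elim: s e lam => // s IH e lam ls eW lam0.
have dvd0 g : (forall i, 'X^(lam i) %| g i) -> lincomb g e = 0.
  move=> gd; rewrite /lincomb big1 // => i _.
  by have /dvdpP[q ->] := gd i; rewrite pactM lam0 linear0.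
have [[g1 [g1e [j ndvd]]]|norel] :=
    pselect (exists g, lincomb g e = 0 /\ exists j, ~~ ('X^(lam j) %| g j));
  last first.
  exists e, lam; split=> // g; split=> [ge i|]; last exact: dvd0.
  by apply: contrapT => /negP gi; apply: norel; exists g; split=> //; exists i.
(* Dropping the terms that vanish makes [d < lam i0] below. *)
pose g i := if 'X^(lam i) %| g1 i then 0 else g1 i.
have ge : lincomb g e = 0.
  apply/eqP; rewrite -[lincomb g e]subr0 -[X in _ - X]g1e -lincombB.
  apply/eqP/dvd0 => i; rewrite /g; case: ifP => [gi|_].
    by rewrite sub0r dvdpNr.
  by rewrite subrr dvdp0.
have exd : exists d, [exists i, (g i)`_d != 0].
  have [d [h [_ gE h0]]] := valuation_factor ndvd; exists d; apply/existsP.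
  exists j; rewrite /g (negPf ndvd) gE coefXnM ltnn subnn //.
case: (ex_minnP exd) => d /existsP[i0 gd] dmin.
have gE i : g i = 'X^d * drop_poly d (g i).
  rewrite mulrC -[LHS](poly_take_drop d) -[RHS]add0r; congr (_ + _).
  apply/polyP => k; rewrite coef_take_poly coef0; case: ltnP => // kd.
  apply/eqP; apply: contraTT kd => gk; rewrite -leqNgt; apply: dmin.
  by apply/existsP; exists i.
have dlt : (d < lam i0)%N.
  move: gd; rewrite ltnNge; apply: contra => ld.
  have : 'X^(lam i0) %| g i0 by rewrite gE dvdp_mulr // dvdXnXn.
  by rewrite /g; case: ifP => [|->]; rewrite ?coef0.
pose q i := drop_poly d (g i).
have q0 : (q i0)`_0 != 0 by rewrite coef_drop_poly.
pose f := lincomb q e.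
have fd : pact T 'X^d f = 0.
  by rewrite -lincombM -[RHS]ge; apply: eq_bigr => i _; rewrite [in RHS]gE.
have [r rP] := inverse_mod_Xn (lam i0) q0.
pose e' i := if i == i0 then f else e i.
pose lam' i := if i == i0 then d else lam i.
apply: (IH e' lam').
- rewrite ltnS in ls; apply: leq_trans ls.
  rewrite (bigD1 i0) // [in leqRHS](bigD1 i0) //=.
  rewrite /lam' eqxx -addSn leq_add //; apply: leq_sum => i /negPf ->.
  exact: leqnn.
- apply: (generates_change eW) => i; rewrite /e'.
    by case: eqP => _; [apply/eW; exists q | apply: generates_mem eW].
  have [->|ni] := eqVneq i i0; last first.
    exists (fun k => if k == i then 1 else 0).
    by rewrite lincomb_single (negPf ni) pact1.
  (* [r * q i0] acts as the identity on [e i0]. *)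
  have -> : e i0 = pact T (r * q i0) (e i0).
    apply/eqP; rewrite -subr_eq0 -{1}[e i0](pact1 T) -pactB -opprB.
    have /dvdpP[p ->] := rP.
    by rewrite -mulNr pactM lam0 linear0.
  rewrite pactM.
  exists (fun i => r * (if i == i0 then 1 else - q i)).
  rewrite lincombM; congr (pact T r _).
  rewrite /lincomb (bigD1 i0) //= eqxx pact1 /f /lincomb [in RHS](bigD1 i0) //=.
  rewrite -addrA -big_split big1 ?addr0 // => k /negPf -> /=.
  by rewrite linearN /= opp_lfunE subrr.
- move=> i; rewrite /e' /lam'; case: eqP => // _; exact: lam0.
Qed.

(** The Jordan normal form of a nilpotent operator. *)
Theorem jordan_presentation W : invariant T W ->
  exists n (e : 'I_n -> V) lam, presents e lam W /\ forall i, (0 < lam i)%N.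
Proof.
move=> Winv; pose e (i : 'I_(\dim W)) := (vbasis W)`_i.
have eW : generates e W.
  move=> v; split=> [/coord_vbasis vE|[g ->]].
    exists (fun i => (coord (vbasis W) i v)%:P); rewrite {1}vE.
    by apply: eq_bigr => i _; rewrite -alg_polyC pactZ pact1.
  apply: lincomb_stable => // i; apply/vbasis_mem/mem_nth.
  by rewrite size_tuple.
have [|e' [lam [eW' rel]]] := presentation_exists eW (lam := fun=> N).
  by move=> i; rewrite pact_Xn0.
pose P := [pred i | 0 < lam i]%N.
exists #|P|, (e' \o enum_val), (lam \o enum_val (A := P)); split; last first.
  by move=> i; have := enum_valP i.
apply: (presents_reindex (h := enum_val (A := P)) (lam := lam)) => //.
  exact: enum_val_inj.
move=> i lami; have iP : i \in P by [].
by apply/codomP; exists (enum_rank_in iP i); rewrite enum_rankK_in.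
Qed.

End Nilpotent.

(** The kernel has the basis [X^(lam i - 1) e i], the socles of the blocks. *)
Lemma nker_presents n (e : 'I_n -> V) lam W :
  presents e lam W -> (forall i, 0 < lam i)%N -> nker T W = n.
Proof.
move=> [eW rel] lam0; pose X := [tuple pact T 'X^((lam i).-1) (e i) | i < n].
suff : basis_of (ker_restr T W) X by exact: size_basis.
have XE (c : 'I_n -> K) :
    \sum_i c i *: X`_i = lincomb (fun i => c i *: 'X^((lam i).-1)) e.
  by apply: eq_bigr => i _; rewrite -tnth_nth tnth_mktuple pactZ.
apply/andP; split; last first.
  apply/freeP => c; rewrite XE => /rel cd i.
  by apply: dvdXn_mul_const (cd i); rewrite prednK.
apply/eqP/vspaceP => v; apply/idP/idP => [/coord_span ->|].
  rewrite XE memv_cap memv_ker; apply/andP; split; first by apply/eW; eexists.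
  rewrite -pactX -lincombM; apply/eqP/rel => i; rewrite -scalerAr -exprS prednK //.
  by rewrite -mul_polyC dvdp_mull.
rewrite memv_cap memv_ker => /andP[/eW[g ->]]; rewrite -pactX -lincombM.
move=> /eqP/rel gd.
have {}gd i : 'X^((lam i).-1) %| g i.
  by have := gd i; rewrite -[X in X * _]expr1 dvdXn_mulXn subn1.
have -> : lincomb g e = \sum_i (g i)`_(lam i).-1 *: X`_i.
  apply/eqP; rewrite XE -subr_eq0 -lincombB; apply/eqP/rel => i.
  apply/dvdXnP => k kl; rewrite coefB coefZ coefXn.
  case: eqP => [->|nk]; first by rewrite mulr1 subrr.
  by rewrite mulr0 subr0; apply: (dvdXnP _ _ (gd i)); lia.
by apply: memv_suml => i _; apply/memvZ/memv_span/mem_nth; rewrite size_tuple.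
Qed.

End Presentations.

(** * Homomorphisms out of a presented module *)

(** The universal property of a presentation; similarities between triples are
    built from it. *)
Lemma presents_lift (K : fieldType) (V V' : vectType K) (T : 'End(V))
    (T' : 'End(V')) (I : finType) (e : I -> V) lam (e' : I -> V') :
  presents T e lam fullv -> (forall i, pact T' 'X^(lam i) (e' i) = 0) ->
  exists2 f : 'Hom(V, V'), (f \o T = T' \o f)%VF & forall i, f (e i) = e' i.
Proof.
move=> [eV rel] lam0.
have eVf v : exists g : I -> {poly K}, v = lincomb T g e by apply/eV/memvf.
have [G GP] := choice eVf.
pose f0 v := lincomb T' (G v) e'.
have f0E g : f0 (lincomb T g e) = lincomb T' g e'.
  apply/eqP; rewrite -subr_eq0 -lincombB; apply/eqP.
  have /rel gd : lincomb T (fun i => G (lincomb T g e) i - g i) e = 0.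
    by rewrite lincombB -GP subrr.
  by apply: big1 => i _; have /dvdpP[q ->] := gd i; rewrite pactM lam0 linear0.
have f0_lin : linear f0.
  move=> c v w; rewrite {1}(GP v) {1}(GP w) -lincombZ -lincombD f0E.
  by rewrite lincombD lincombZ.
pose f0l : {linear V -> V'} :=
  HB.pack f0 (GRing.isLinear.Build K V V' _ f0 f0_lin).
exists (linfun f0l).
  apply/lfunP => v; rewrite !comp_lfunE !lfunE /= (GP v) -pactX -lincombM !f0E.
  by rewrite lincombM pactX.
move=> i; rewrite lfunE /= -[e i](pact1 T) -lincomb_single f0E.
by rewrite lincomb_single pact1.
Qed.

(** * Existence of modules with prescribed block sizes *)

Section BlockModule.
Variables (K : fieldType) (n : nat) (lam : 'I_n -> nat).

Let box := {i : 'I_n & 'I_(lam i)}.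
Let blocks : vectType K := {ffun box -> K^o}.

(** The basis vector in position [k] of block [i]; it is [0] when [k] lies
    beyond the end of the block, so that the shift needs no case distinction. *)
Let boxvec (i : 'I_n) (k : nat) : blocks :=
  [ffun x : box => ((tag x == i) && (tagged x == k :> nat))%:R].

Let shift0 (v : blocks) : blocks :=
  \sum_(x : box) v x *: boxvec (tag x) (tagged x).+1.

Fact shift0_is_linear : linear shift0.
Proof.
move=> c v w; rewrite /shift0 scaler_sumr -big_split; apply: eq_bigr => x _ /=.
by rewrite !ffunE scalerDl scalerA.
Qed.
HB.instance Definition _ :=
  GRing.isLinear.Build K blocks blocks _ shift0 shift0_is_linear.

Let shift : 'End(blocks) := linfun shift0.

Lemma boxvec_eq0 i k : (lam i <= k)%N -> boxvec i k = 0.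
Proof.
move=> lk; apply/ffunP => x; rewrite !ffunE; case: eqP => //= xi.
by rewrite ltn_eqF // (leq_trans (ltn_ord (tagged x))) // xi.
Qed.

Lemma shift_boxvec i k : shift (boxvec i k) = boxvec i k.+1.
Proof.
rewrite lfunE /=; have [ki|ik] := ltnP k (lam i); last first.
  by rewrite !boxvec_eq0 ?(leqW ik) // linear0.
pose x0 : box := Tagged (fun i => 'I_(lam i)) (Ordinal ki).
rewrite /= /shift0 (bigD1 x0) //= ffunE /= !eqxx scale1r big1 ?addr0 // => x xx0.
rewrite ffunE; case: eqP => [xi|]; last by rewrite scale0r.
case: eqP => [xk|]; last by rewrite scale0r.
case/eqP: xx0; case: x xi xk => j y /= ji; rewrite {j}ji in y * => yk.
by congr existT; apply: val_inj.
Qed.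

Lemma pact_boxvec g i (x : box) :
  pact shift g (boxvec i 0) x = if tag x == i then g`_(tagged x) else 0.
Proof.
have XnE k : pact shift 'X^k (boxvec i 0) = boxvec i k.
  elim: k => [|k IH]; first by rewrite expr0 pact1.
  by rewrite exprSr pactMX IH shift_boxvec.
pose m := maxn (size g) (tagged x).+1.
rewrite (@pact_widen _ _ _ m) ?leq_maxl // !sum_lfunE sum_ffunE.
have xm : (tagged x < m)%N by rewrite leq_max leqnn orbT.
rewrite (bigD1 (Ordinal xm)) //= big1 ?addr0 => [|k kx].
  rewrite scale_lfunE -pactXn XnE !ffunE eqxx andbT.
  by case: eqP => _; rewrite ?[_ *: _]mulr1 ?[_ *: _]mulr0.
rewrite scale_lfunE -pactXn XnE !ffunE [tagged x == k :> nat]eq_sym.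
have -> : (k == tagged x :> nat) = false by apply: contraNF kx.
by rewrite andbF [_ *: _]mulr0.
Qed.

Lemma lincomb_boxvec g (x : box) :
  lincomb shift g (boxvec^~ 0%N) x = (g (tag x))`_(tagged x).
Proof.
rewrite /lincomb sum_ffunE (bigD1 (tag x)) //= pact_boxvec eqxx.
rewrite big1 ?addr0 // => i ix.
by rewrite pact_boxvec eq_sym (negPf ix).
Qed.

Lemma block_module_presents : presents shift (boxvec^~ 0%N) lam fullv.
Proof.
split=> [v|g].
  split=> [_|]; last by rewrite memvf.
  exists (fun i => \sum_(k < lam i) v (Tagged (fun i => 'I_(lam i)) k) *: 'X^k).
  apply/ffunP => -[i k]; rewrite lincomb_boxvec /= coef_sum (bigD1 k) //=.
  rewrite coefZ coefXn eqxx mulr1 big1 ?addr0 // => j jk.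
  rewrite coefZ; have -> : ('X^j : {poly K})`_k = 0.
    by rewrite coefXn eq_sym (negPf jk : (j == k :> nat) = false).
  by rewrite mulr0.
split=> [/ffunP g0 i|g0].
  apply/dvdXnP => k ki.
  have := g0 (Tagged (fun i => 'I_(lam i)) (Ordinal ki)).
  by rewrite lincomb_boxvec ffunE.
apply/ffunP => x; rewrite lincomb_boxvec ffunE.
exact: (dvdXnP _ _ (g0 _)).
Qed.

Lemma block_module_exists :
  exists (V : vectType K) (T : 'End(V)) (e : 'I_n -> V),
    presents T e lam fullv /\ lfun_exp T (\max_i lam i) = 0.
Proof.
exists blocks, shift, (boxvec^~ 0%N); split; first exact: block_module_presents.
have [gen rel] := block_module_presents.
apply/lfunP => v; have /gen[g ->] := memvf v; rewrite lfunE -pactXn -lincombM.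
by apply/rel => i; rewrite dvdp_mulr // dvdXnXn (bigmax_sup i).
Qed.

End BlockModule.

(** * Triples in normal form *)

Section NormalForms.
Variable K : fieldType.
Implicit Types X Y : triple K.

Lemma tsimilar_sym X Y : tsimilar X Y -> tsimilar Y X.
Proof.
move=> [f [fbij fU fT]].
have kerf : lker f == 0%VS by apply/lker0P; exact: bij_inj.
have imf : limg f = fullv.
  apply/eqP; rewrite eqEsubv subvf; apply/subvP => w _.
  by case: fbij => g _ gK; rewrite -(gK w) memv_img ?memvf.
have fVK : cancel f^-1%VF f.
  by move=> w; apply: limg_lfunVK; rewrite imf memvf.
exists f^-1%VF; split.
- by exists f => //; exact: lker0_lfunK.
- apply/vspaceP => v; apply/memv_imgP/idP => [[w] | vU].
    by rewrite -fU => /memv_imgP[u uU ->] ->; rewrite lker0_lfunK.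
  by exists (f v); rewrite ?lker0_lfunK // -fU memv_img.
apply/lfunP => w; rewrite !comp_lfunE -{1}(fVK w) -[oper Y _]comp_lfunE -fT.
by rewrite comp_lfunE lker0_lfunK.
Qed.

Lemma tsimilar_trans X Y Z : tsimilar X Y -> tsimilar Y Z -> tsimilar X Z.
Proof.
move=> [f [fbij fU fT]] [g [gbij gU gT]]; exists (g \o f)%VF; split.
- by apply: (eq_bij (bij_comp gbij fbij)) => v; rewrite comp_lfunE.
- by rewrite limg_comp fU.
- by rewrite -comp_lfunA fT comp_lfunA gT -comp_lfunA.
Qed.

Lemma tsimilar_refl X : tsimilar X X.
Proof.
exists \1%VF; split; first by exists id => v; rewrite lfunE.
  exact: lim1g.
by rewrite comp_lfun1l comp_lfun1r.
Qed.

Lemma tsimilar_class_eq X Y : tsimilar X Y -> tsimilar X = tsimilar Y.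
Proof.
move=> XY; apply/funext => Z; apply/propext; split; apply: tsimilar_trans => //.
exact: tsimilar_sym.
Qed.

Section OneTriple.
Variables (V : vectType K) (T : 'End(V)).

Definition cyclic (u : V) (U : {vspace V}) : Prop :=
  forall v, v \in U <-> exists g, v = pact T g u.

Lemma generates1 (e : 'I_1 -> V) U : generates T e U <-> cyclic (e ord0) U.
Proof.
by split=> eU v; (split; first (move=> /eU[g ->])) => [|[g ->]];
  [exists (g ord0) | apply/eU; exists (fun=> g)
  |exists (fun=> g) | apply/eU; exists (g ord0)];
  rewrite /lincomb big_ord1.
Qed.

Lemma cyclic_sub u U W : cyclic u U -> invariant T W -> u \in W -> (U <= W)%VS.
Proof. by move=> uU Winv uW; apply/subvP => v /uU[g ->]; apply: pact_stable. Qed.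

Lemma cyclic_mem u U : cyclic u U -> u \in U.
Proof. by move=> uU; apply/uU; exists 1; rewrite pact1. Qed.

Definition marked n (a : 'I_n -> nat) (e : 'I_n -> V) : V :=
  lincomb T (fun i => 'X^(a i)) e.

Lemma pact_marked n (a : 'I_n -> nat) e g :
  pact T g (marked a e) = lincomb T (fun i => 'X^(a i) * g) e.
Proof.
by rewrite -lincombM; apply: eq_bigr => i _; rewrite mulrC.
Qed.

(** The order of a sum of vectors from distinct blocks is the largest of their
    orders. *)
Lemma marked_presents n (a b : 'I_n -> nat) e U :
  free_relations T e (fun i => a i + b i)%N -> cyclic (marked a e) U ->
  presents T (fun _ : 'I_1 => marked a e) (fun=> \max_i b i) U.
Proof.
move=> rel uU; split; first exact/generates1.
move=> g; rewrite {1}/lincomb big_ord1 pact_marked; split.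
  move=> /rel gd i; rewrite (ord1 i); apply/dvdXnP => k kb.
  have [j kbj] : exists j, (k < b j)%N.
    apply: contrapT => no; move: kb; apply/negP; rewrite -leqNgt.
    apply/bigmax_leqP => j _; rewrite leqNgt; apply/negP => kbj.
    by apply: no; exists j.
  by have := gd j; rewrite dvdXn_mulXn addKn => /dvdXnP/(_ k kbj).
move=> gd; apply/rel => i; rewrite dvdXn_mulXn addKn.
by apply: dvdp_trans (gd ord0); rewrite dvdXnXn (bigmax_sup i).
Qed.

(** The vector [X^k u] lies in [T^(k + j) V] when each of its components
    [X^(a i + k) e i] does; such a component is zero for [k >= b i], and has
    height exactly [a i + k] for [k < b i]. *)
Lemma marked_height n (a b : 'I_n -> nat) e U k j :
  presents T e (fun i => a i + b i)%N fullv -> cyclic (marked a e) U ->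
  ~~ (pact T 'X^k @: U <= limg (pact T 'X^(k + j)))%VS <->
  exists i, (k < b i)%N /\ (a i < j)%N.
Proof.
move=> [gen rel] uU.
have imP : (pact T 'X^k @: U <= limg (pact T 'X^(k + j)))%VS <->
    exists g : 'I_n -> {poly K}, forall i,
      'X^(a i + b i) %| 'X^(a i) * 'X^k - 'X^(k + j) * g i.
  split=> [/subvP sub|[g gd]].
    have /memv_imgP[v _] := sub _ (memv_img (pact T 'X^k) (cyclic_mem uU)).
    have /gen[g ->] := memvf v; rewrite -lincombM pact_marked => /eqP.
    by rewrite -subr_eq0 -lincombB => /eqP/rel gd; exists g.
  apply/subvP => _ /memv_imgP[v /uU[h ->] ->].
  rewrite -pactM mulrC pactM; apply: pact_stable.
    apply/invariantP => _ /memv_imgP[w _ ->].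
    by rewrite -pactX -pactM mulrC pactM memv_img ?memvf.
  suff -> : pact T 'X^k (marked a e) = pact T 'X^(k + j) (lincomb T g e).
    by rewrite memv_img ?memvf.
  apply/eqP; rewrite pact_marked -lincombM -subr_eq0 -lincombB.
  exact/eqP/rel.
split=> [no|[i [kb aj]]].
  apply: contrapT => nex; apply: (negP no).
  apply/imP; exists (fun i => 'X^(a i - j)) => i; rewrite -!exprD.
  have [kb|bk] := ltnP k (b i).
    have ja : (j <= a i)%N.
      by rewrite leqNgt; apply/negP => aj; apply: nex; exists i.
    rewrite (_ : k + j + (a i - j) = a i + k)%N ?subrr ?dvdp0 //; lia.
  by rewrite dvdp_sub ?dvdXnXn ?leq_add2l //; lia.
(* The coefficient of degree [a i + k] obstructs the divisibility. *)
apply/negP => /imP[g /(_ i)/dvdXnP/(_ (a i + k)%N)].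
rewrite ltn_add2l => /(_ kb)/eqP; apply/negP.
rewrite -exprD coefB coefXn eqxx coefXnM ifT ?subr0 ?oner_eq0 //; lia.
Qed.

End OneTriple.

(** The numbers [a i] and [b i] are the exponent of [X] in the [i]-th component of
    the generator of the subspace and the order of that component; the block has
    size [a i + b i]. *)
Definition normal_form X n (a b : 'I_n -> nat) : Prop :=
  exists2 e : 'I_n -> Defs.space X,
    presents (oper X) e (fun i => a i + b i)%N fullv &
    cyclic (oper X) (marked (oper X) a e) (subsp X).

Lemma normal_form_exists n (a b : 'I_n -> nat) : exists X, normal_form X a b.
Proof.
have [V [T [e [pres TN]]]] := block_module_exists K (fun i => a i + b i)%N.
have eU := module_spanP TN (fun _ : 'I_1 => marked T a e).
have Tnil : exists k, lfun_exp T k = 0 by eexists; exact: TN.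
exists (Triple Tnil (generates_invariant eU)), e => //.
exact: (generates1 _ _ _).1 eU.
Qed.

Lemma normal_form_similar X Y n (a b : 'I_n -> nat) :
  normal_form X a b -> normal_form Y a b -> tsimilar X Y.
Proof.
move=> [e presX cycX] [e' presY cycY].
have [|f fT fe] := presents_lift presX (T' := oper Y) (e' := e').
  by move=> i; apply/(presents_order _ _ presY.2).
have [|g gT ge] := presents_lift presY (T' := oper X) (e' := e).
  by move=> i; apply/(presents_order _ _ presX.2).
have fL := pact_intertwine fT; have gL := pact_intertwine gT.
have fK : cancel f g.
  move=> v; have /presX.1[c ->] := memvf v; rewrite !linear_sum.
  by apply: eq_bigr => i _; rewrite /= fL gL fe ge.
have gK : cancel g f.
  move=> v; have /presY.1[c ->] := memvf v; rewrite !linear_sum.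
  by apply: eq_bigr => i _; rewrite /= gL fL ge fe.
have fu : f (marked (oper X) a e) = marked (oper Y) a e'.
  by rewrite linear_sum; apply: eq_bigr => i _; rewrite /= fL fe.
exists f; split=> //; first by exists g.
apply/vspaceP => w; apply/memv_imgP/idP => [[v /cycX[c ->] ->]|/cycY[c ->]].
  by apply/cycY; exists c; rewrite fL fu.
exists (pact (oper X) c (marked (oper X) a e)); last by rewrite fL fu.
by apply/cycX; exists c.
Qed.

End NormalForms.

(** * Indecomposability of normal forms *)

Definition comonotone n (a b : 'I_n -> nat) : Prop :=
  forall i j, i != j -> (a i < a j)%N && (b i < b j)%N
                     || (a j < a i)%N && (b j < b i)%N.

Section Indecomposable.
Variable K : fieldType.
Implicit Types X Y : triple K.

Lemma invariant_kernel (V : vectType K) (T : 'End(V)) N (W : {vspace V}) :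
  lfun_exp T N = 0 -> invariant T W -> W != 0%VS ->
  exists z, [/\ z \in W, z != 0 & T z = 0].
Proof.
move=> TN Winv W0; have [w0 wW] := (vpick0 W, memv_pick W).
have exk : exists k, pact T 'X^k (vpick W) == 0.
  by exists N; rewrite pactXn TN lfunE.
case: (ex_minnP exk) => -[|k] /eqP kw kmin.
  by move: kw; rewrite expr0 pact1 => /eqP; rewrite w0 (negPf W0).
exists (pact T 'X^k (vpick W)); split; first exact: pact_stable.
  by apply/negP => /kmin; rewrite ltnn.
by rewrite -pactMX -exprSr.
Qed.

Lemma limg_pact_memE (V : vectType K) (T : 'End(V)) k v :
  v \in limg (pact T 'X^k) <-> exists w, v = pact T 'X^k w.
Proof.
by split=> [/memv_imgP[w _ ->]|[w ->]]; [exists w | rewrite memv_img ?memvf].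
Qed.

(** Let [V] be the direct sum of [V1] and [V2], with [u \in V1], and let [z] be a
    nonzero kernel vector of [V2] that lies in [T^h V] but not in [T^(h+1) V].
    Modulo [T^(h+1) V] the kernel vectors of [T^h V] are spanned by the last
    basis vectors of the blocks of size [h + 1]; there is at most one such block
    [j], and comonotonicity makes [X^(b j - 1) u], a vector of [V1], congruent
    to its last basis vector.  So [z] is congruent to a vector of [V1], and
    projecting to [V2] puts [z] in [T^(h+1) V]. *)
Lemma complement_of_marked (V : vectType K) (T : 'End(V)) N n
    (a b : 'I_n -> nat) (e : 'I_n -> V) (V1 V2 : {vspace V}) :
  lfun_exp T N = 0 -> presents T e (fun i => a i + b i)%N fullv ->
  (forall i, 0 < b i)%N -> comonotone a b ->
  invariant T V1 -> invariant T V2 -> (V1 :&: V2 = 0)%VS ->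
  fullv = (V1 + V2)%VS -> marked T a e \in V1 -> V2 = 0%VS.
Proof.
move=> TN [gen rel] b0 mono inv1 inv2 cap12 sum12 uV1.
apply/eqP; apply: contrapT => /negP V20.
have [z [zV2 z0 Tz]] := invariant_kernel TN inv2 V20.
have exh : exists h, z \notin limg (pact T 'X^h).
  exists N; apply/negP => /limg_pact_memE[w zE].
  by move: z0; rewrite zE pactXn TN lfunE eqxx.
case: (ex_minnP exh) => -[|h] zh hmin.
  by case/negP: zh; apply/limg_pact_memE; exists z; rewrite expr0 pact1.
have /limg_pact_memE[y zE] : z \in limg (pact T 'X^h).
  by apply: contrapT => /negP/hmin; rewrite ltnn.
suff [w wV1 [y' zwE]] :
    exists2 w, w \in V1 & exists y', z - w = pact T 'X^(h.+1) y'.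
  case/negP: zh; apply/limg_pact_memE.
  have /memv_addP[y1 y1V1 [y2 y2V2 y'E]] : y' \in (V1 + V2)%VS.
    by rewrite -sum12 memvf.
  exists y2; apply/eqP; rewrite -subr_eq0 -memv0 -cap12 memv_cap.
  rewrite [_ \in V2]memvB ?pact_stable // andbT.
  have -> : z - pact T 'X^(h.+1) y2 = w + pact T 'X^(h.+1) y1.
    have -> : pact T 'X^(h.+1) y1 = pact T 'X^(h.+1) y' - pact T 'X^(h.+1) y2.
      by rewrite y'E linearD addrK.
    by rewrite -zwE addrA addrCA subrr addr0.
  by rewrite memvD ?pact_stable.
have /gen[g yE] := memvf y.
have gd i : 'X^(a i + b i) %| 'X^(h.+1) * g i.
  move: i; apply/rel; rewrite lincombM -yE exprS pactM -zE pactX Tz //.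
(* Modulo [T^(h+1) V] only the constant terms of the [g i] matter, and they
   contribute only for blocks of size [h + 1]. *)
have gE i : 'X^h * g i - 'X^(h.+1) * drop_poly 1 (g i) = (g i)`_0 *: 'X^h.
  rewrite -{1}(poly_take_drop 1 (g i)) expr1 exprS.
  have -> : take_poly 1 (g i) = ((g i)`_0)%:P.
    by apply/polyP => k; rewrite coef_take_poly coefC; case: k.
  by rewrite -mul_polyC; ring.
have gh i : (a i + b i)%N != h.+1 -> 'X^(a i + b i) %| (g i)`_0 *: 'X^h.
  case: (ltngtP (a i + b i)%N h.+1) => // ih _.
    by rewrite -mul_polyC dvdp_mull ?dvdXnXn.
  have := gd i; rewrite dvdXn_mulXn => /dvdXnP -> //; last by rewrite subn_gt0.
  by rewrite scale0r dvdp0.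
have zL : z = lincomb T (fun i => 'X^h * g i) e by rewrite lincombM -yE.
have [[j jh]|noj] := pselect (exists j, (a j + b j)%N = h.+1); last first.
  exists 0; first exact: mem0v.
  exists (lincomb T (fun i => drop_poly 1 (g i)) e).
  rewrite subr0 zL -lincombM; apply/eqP; rewrite -subr_eq0 -lincombB.
  apply/eqP/rel => i; rewrite gE; apply: gh; apply/eqP => ih.
  by apply: noj; exists i.
(* The components of [X^(b j - 1) u] in the other blocks are zero if [b i < b j],
   and equal to [X^(h+1) r i e i] if [a i > a j]. *)
pose c := (g j)`_0; exists (c *: pact T 'X^((b j).-1) (marked T a e)).
  by rewrite memvZ ?pact_stable.
pose r i : {poly K} :=
  if (i != j) && (a j < a i)%N then 'X^((a i - a j).-1) else 0.
exists (lincomb T (fun i => drop_poly 1 (g i) - c *: r i) e).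
rewrite zL pact_marked -lincombZ -lincombB -lincombM.
apply/eqP; rewrite -subr_eq0 -lincombB; apply/eqP/rel => i.
have -> : 'X^h * g i - c *: ('X^(a i) * 'X^((b j).-1)) -
          'X^(h.+1) * (drop_poly 1 (g i) - c *: r i) =
          (g i)`_0 *: 'X^h - c *: ('X^(a i + (b j).-1) - 'X^(h.+1) * r i).
  by rewrite -gE exprD -!mul_polyC; ring.
have bj := b0 j; rewrite /r.
have [->|ij] /= := eqVneq i j.
  rewrite (_ : a j + (b j).-1 = h)%N ?mulr0 ?subr0 ?subrr ?dvdp0 //; lia.
have bi := b0 i; have := mono _ _ ij.
case: (ltnP (a j) (a i)) => [aji|aij] order.
  rewrite -exprD (_ : h.+1 + (a i - a j).-1 = a i + (b j).-1)%N; last by lia.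
  by rewrite subrr scaler0 subr0; apply: gh; apply/eqP; lia.
rewrite mulr0 subr0 dvdp_sub //; first by apply: gh; apply/eqP; lia.
by rewrite -mul_polyC dvdp_mull // dvdXnXn; lia.
Qed.

(** As [ker T] meets [U] in a line, [U] cannot meet both summands of a
    decomposition, so it lies in one of them and the other one is zero. *)
Lemma normal_form_indecomposable X n (a b : 'I_n -> nat) :
  normal_form X a b -> (forall i, 0 < b i)%N -> comonotone a b ->
  nker (oper X) (subsp X) = 1%N -> indecomposable X.
Proof.
move=> [e pres uU] b0 mono kerU V1 V2 inv1 inv2 dir full dirU UE.
have [N TN] := oper_nilpotent X.
have cap12 := directv_addP dir.
have [U1|U1] := eqVneq (subsp X :&: V1)%VS 0%VS.
  left; apply: (complement_of_marked TN pres b0 mono inv2 inv1).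
  - by rewrite capvC.
  - by rewrite addvC.
  by move: (cyclic_mem uU); rewrite UE U1 add0v memv_cap => /andP[].
have [U2|U2] := eqVneq (subsp X :&: V2)%VS 0%VS.
  right; apply: (complement_of_marked TN pres b0 mono inv1 inv2) => //.
  by move: (cyclic_mem uU); rewrite UE U2 addv0 memv_cap => /andP[].
have kernel_in W : invariant (oper X) W -> (subsp X :&: W != 0)%VS ->
    exists z, [/\ z \in W, z != 0 & z \in ker_restr (oper X) (subsp X)].
  move=> Winv UW0; have Uinv : invariant (oper X) (subsp X) := subsp_invariant X.
  have UWinv : invariant (oper X) (subsp X :&: W)%VS.
    apply/invariantP => v; rewrite !memv_cap => /andP[vU vW].
    by rewrite (invariantP _ _ Uinv) // (invariantP _ _ Winv).
  have [z [zUW z0 Tz]] := invariant_kernel TN UWinv UW0.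
  move: zUW; rewrite memv_cap => /andP[zU zW]; exists z; split=> //.
  by rewrite memv_cap zU memv_ker Tz eqxx.
have [z1 [z1V1 z10 z1L]] := kernel_in V1 inv1 U1.
have [z2 [z2V2 z20 z2L]] := kernel_in V2 inv2 U2.
have line : (<[z1]> == ker_restr (oper X) (subsp X))%VS.
  by rewrite eqEdim -memvE z1L dim_vline z10 /= -kerU.
case/negP: z20; rewrite -memv0 -cap12 memv_cap z2V2 andbT.
by move: z2L; rewrite -(eqP line) => /vlineP[c ->]; rewrite memvZ.
Qed.

Lemma normal_form_nker X n (a b : 'I_n -> nat) :
  normal_form X a b -> (forall i, 0 < b i)%N -> nker (oper X) fullv = n.
Proof.
move=> [e pres _] b0; apply: nker_presents pres _ => i.
by rewrite addn_gt0 b0 orbT.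
Qed.

Lemma normal_form_nker_subsp X n (a b : 'I_n -> nat) :
  normal_form X a b -> (forall i, 0 < b i)%N -> (0 < n)%N ->
  nker (oper X) (subsp X) = 1%N.
Proof.
move=> [e [_ rel] uU] b0 n0; apply: nker_presents (marked_presents rel uU) _ => _.
by apply: leq_trans (b0 (Ordinal n0)) _; apply: (bigmax_sup (Ordinal n0)).
Qed.

Lemma normal_form_order X n (a b : 'I_n -> nat) p :
  normal_form X a b -> (0 < p)%N ->
  nilpotency_order (oper X) p <->
  (forall i, a i + b i <= p)%N /\ exists i, (a i + b i)%N = p.
Proof.
move=> [e [gen rel] _] p0.
have exp0 k : lfun_exp (oper X) k = 0 <-> forall i, (a i + b i <= k)%N.
  split=> [Tk i|lk].
    by apply/(presents_order _ _ rel); rewrite pactXn Tk lfunE.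
  apply/lfunP => v; have /gen[g ->] := memvf v; rewrite lfunE -pactXn -lincombM.
  by apply/rel => i; rewrite dvdp_mulr // dvdXnXn.
split=> [[_ /exp0 lp nlp]|[lp [i ip]]]; last first.
  split=> //; first exact/exp0.
  by move=> /exp0/(_ i); rewrite ip; lia.
split=> //; apply: contrapT => no; apply: nlp; apply/exp0 => i.
have : (a i + b i)%N != p by apply/eqP => ip; apply: no; exists i.
by move: (lp i); lia.
Qed.

(** * Reduction of indecomposable triples to normal form *)

Section Reduction.
Variables (X : triple K) (u : Defs.space X) (N : nat).
Hypothesis X_indec : indecomposable X.
Hypothesis uU : cyclic (oper X) u (subsp X).
Hypothesis u0 : u != 0.
Hypothesis TN : lfun_exp (oper X) N = 0.
Let T := oper X.

Lemma indecomposable_complement V1 V2 :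
  invariant T V1 -> invariant T V2 -> (V1 :&: V2 = 0)%VS ->
  fullv = (V1 + V2)%VS -> u \in V1 -> V2 = 0%VS.
Proof.
move=> inv1 inv2 cap12 sum12 uV1.
have UV1 := cyclic_sub uU inv1 uV1.
have UV2 : (subsp X :&: V2 = 0)%VS.
  by apply/eqP; rewrite -subv0 -cap12 capvS.
have [] // := X_indec inv1 inv2 _ sum12.
- exact/directv_addP.
- by apply/directv_addP; rewrite UV2 capv0.
- by rewrite UV2 addv0; apply/esym/capv_idPl.
by move=> V10; move: uV1; rewrite V10 memv0 (negPf u0).
Qed.

(** If the component of [u] along [e i] is zero, then [U] lies in the sum of the
    other blocks, and the block of [e i] is a complement. *)
Lemma component_neq0 n (e : 'I_n -> Defs.space X) lam g i :
  presents T e lam fullv -> u = lincomb T g e -> 'X^(lam i) %| g i ->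
  lam i = 0%N.
Proof.
move=> [gen rel] uE gd; pose e1 j := if j == i then 0 else e j.
pose V1 := module_span T N e1; pose V2 := module_span T N (fun _ : 'I_1 => e i).
have e1V1 : generates T e1 V1 := module_spanP TN e1.
have eV2 : cyclic T (e i) V2.
  exact: (generates1 _ _ _).1 (module_spanP TN (fun _ : 'I_1 => e i)).
have ei0 q : pact T q (e i) = 0 <-> 'X^(lam i) %| q.
  rewrite -lincomb_single; split=> [/rel/(_ i)|qd]; first by rewrite eqxx.
  by apply/rel => j; case: eqP => [->|_]; rewrite ?dvdp0.
have split_i h : lincomb T h e = lincomb T h e1 + pact T (h i) (e i).
  rewrite /lincomb (bigD1 i) //= [in RHS](bigD1 i) //= /e1 eqxx linear0 add0r.
  by rewrite addrC; congr (_ + _); apply: eq_bigr => j /negPf ->.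
suff V20 : V2 = 0%VS.
  have : e i \in V2 by exact: cyclic_mem eV2.
  rewrite V20 memv0 => /eqP ei; apply/eqP; rewrite -leqn0.
  by apply/(presents_order _ _ rel); rewrite ei linear0.
apply: (@indecomposable_complement V1 V2).
- exact: generates_invariant e1V1.
- exact: generates_invariant (module_spanP TN _).
- apply/eqP; rewrite -subv0; apply/subvP => v; rewrite memv_cap memv0.
  case/andP => /e1V1[h vh] /eV2[q vq].
  pose h' j := if j == i then - q else h j.
  have /rel/(_ i) : lincomb T h' e = 0.
    rewrite split_i /h' eqxx linearN /= opp_lfunE -vq vh.
    apply/eqP; rewrite subr_eq0; apply/eqP; apply: eq_bigr => j _.
    by rewrite /e1; case: eqP => _; rewrite ?linear0.
  by rewrite /h' eqxx dvdpNr => /ei0; rewrite -vq => ->.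
- apply/eqP; rewrite eqEsubv subvf andbT; apply/subvP => v /gen[h ->].
  by rewrite split_i memv_add //; [apply/e1V1; exists h | apply/eV2; eexists].
rewrite uE split_i (ei0 _).2 // addr0; apply/e1V1; by exists g.
Qed.

(** If [a i <= a j] and [b j <= b i], the generator [e i + X^(a j - a i) e j] has
    the same order as [e i] and absorbs the component of [u] along [e j]. *)
Lemma marked_comonotone n (e : 'I_n -> Defs.space X) a b :
  presents T e (fun i => a i + b i)%N fullv -> u = marked T a e ->
  (forall i, 0 < b i)%N -> comonotone a b.
Proof.
move=> [gen rel] uE b0.
suff no i j : i != j -> (a i <= a j)%N -> (b j <= b i)%N -> False.
  move=> i j ij; have ji : j != i by rewrite eq_sym.
  apply/idP/negPn/negP => order; have [/andP[aij bij]|not_ij] :=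
    boolP ((a i <= a j) && (b j <= b i))%N; first exact: no ij aij bij.
  by apply: (no _ _ ji); lia.
move=> ij ale ble; have ji : j != i by rewrite eq_sym.
pose f k := if k == i then e i + pact T 'X^(a j - a i) (e j) else e k.
have fE g : lincomb T g f =
    lincomb T (fun k => g k + (if k == j then g i * 'X^(a j - a i) else 0)) e.
  rewrite lincombD lincomb_single pactM.
  rewrite [in LHS]/lincomb (bigD1 i) //= {1}/f eqxx linearD /=.
  rewrite [in RHS]/lincomb [in RHS](bigD1 i) //= -!addrA; congr (_ + _).
  rewrite addrC; congr (_ + _); apply: eq_bigr => k /negPf ki.
  by rewrite /f ki.
have fgen : generates T f fullv.
  apply: (generates_change TN gen) => [k|k]; first exact: memvf.
  have [->|/negPf ki] := eqVneq k i.
    exists (fun k => (if k == i then 1 else 0) -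
                     (if k == j then 'X^(a j - a i) else 0)).
    by rewrite lincombB !lincomb_single pact1 /f eqxx (negPf ji) addrK.
  by exists (fun l => if l == k then 1 else 0); rewrite lincomb_single pact1 /f ki.
have frel : free_relations T f (fun k => a k + b k)%N.
  move=> g; rewrite fE.
  have gj : 'X^(a i + b i) %| g i -> 'X^(a j + b j) %| g i * 'X^(a j - a i).
    move=> gi; apply: dvdp_trans (dvdp_mul gi (dvdpp _)).
    by rewrite -exprD dvdXnXn; lia.
  split=> [/rel gd k|gd].
    have gi : 'X^(a i + b i) %| g i by have := gd i; rewrite (negPf ij) addr0.
    have := gd k; case: eqP => [->|_]; last by rewrite addr0.
    by rewrite dvdp_addl // gj.
  apply/rel => k; case: eqP => [->|_]; last by rewrite addr0.
  by rewrite dvdp_addl // gj.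
have uf : u = lincomb T (fun k => if k == j then 0 else 'X^(a k)) f.
  rewrite fE uE (negPf ij) /marked; apply: eq_bigr => k _; congr (pact T _ _).
  by case: eqP => [->|_]; rewrite ?addr0 // add0r -exprD subnKC.
have := component_neq0 (i := j) (conj fgen frel) uf.
by rewrite eqxx dvdp0 => /(_ isT); have := b0 j; lia.
Qed.

End Reduction.

(** The kernel condition makes [U] cyclic; what remains is to absorb the unit
    parts of the components of its generator into the Jordan basis. *)
Lemma indecomposable_normal_form X :
  indecomposable X -> nker (oper X) (subsp X) = 1%N ->
  exists n (a b : 'I_n -> nat),
    [/\ normal_form X a b, forall i, (0 < b i)%N & comonotone a b].
Proof.
move=> indec kerU; have [N TN] := oper_nilpotent X.
have [m [f [mu [presU mu0]]]] := jordan_presentation TN (subsp_invariant X).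
have m1 := nker_presents presU mu0; rewrite kerU in m1.
case: m / m1 f mu presU mu0 => f mu [/generates1 uU relU] mu0.
set u := f ord0 in uU.
have u0 : u != 0.
  apply/eqP => ue; have := (presents_order ord0 0 relU).1.
  rewrite expr0 pact1 => /(_ ue); rewrite leqn0 => /eqP m0.
  by have := mu0 ord0; rewrite m0.
have [n [e [lam [pres lam0]]]] : exists n (e : 'I_n -> Defs.space X) lam,
    presents (oper X) e lam fullv /\ forall i, (0 < lam i)%N.
  by apply: (jordan_presentation TN); apply/invariantP => v _; exact: memvf.
have [gen rel] := pres.
have /gen[g uE] := memvf u.
have factor i : exists adh : nat * {poly K},
    [/\ (adh.1 < lam i)%N, g i = 'X^(adh.1) * adh.2 & (adh.2)`_0 != 0].
  have /valuation_factor[d [h [dl gE h0]]] : ~~ ('X^(lam i) %| g i).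
    apply/negP => /(component_neq0 indec uU u0 TN pres uE) l0.
    by have := lam0 i; rewrite l0.
  by exists (d, h).
have [ah ahP] := choice factor.
pose a i := (ah i).1; pose h i := (ah i).2; pose b i := (lam i - a i)%N.
have hP i : [/\ (a i < lam i)%N, g i = 'X^(a i) * h i & (h i)`_0 != 0].
  exact: ahP.
have lamE : lam = fun i => (a i + b i)%N.
  by apply/funext => i; rewrite subnKC // ltnW //; have [] := hP i.
have b0 i : (0 < b i)%N by rewrite subn_gt0; have [] := hP i.
pose e' i := pact (oper X) (h i) (e i).
have eE' q : lincomb (oper X) q e' = lincomb (oper X) (fun i => q i * h i) e.
  by apply: eq_bigr => i _; rewrite -pactM.
have pres' : presents (oper X) e' lam fullv.
  split.
    apply: (generates_change TN gen) => [i|i]; first exact: memvf.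
    have [_ _ /(inverse_mod_Xn (lam i))[r rP]] := hP i.
    exists (fun j => if j == i then r else 0); rewrite lincomb_single -pactM.
    apply/eqP; rewrite -subr_eq0 -{1}[e i](pact1 (oper X)) -pactB.
    rewrite -lincomb_single; apply/eqP/rel => j.
    by case: eqP => [->|_]; rewrite ?dvdp0 // -opprB dvdpNr.
  move=> q; rewrite eE'; split=> [/rel qd i|qd].
    have [_ _ /(coprimep_Xn (lam i)) cop] := hP i.
    by have := qd i; rewrite Gauss_dvdpl.
  by apply/rel => i; apply/dvdp_mulr.
have uE' : u = marked (oper X) a e'.
  by rewrite uE /marked eE'; apply: eq_bigr => i _; have [_ <- _] := hP i.
rewrite lamE in pres'.
exists n, a, b; split=> //; first by exists e' => //; rewrite -uE'.
exact: (marked_comonotone indec uU u0 TN pres' uE').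
Qed.

(** * The pairs are invariants of the similarity class *)

Lemma tsimilar_height X Y g h : tsimilar X Y ->
  (pact (oper X) g @: subsp X <= limg (pact (oper X) h))%VS ->
  (pact (oper Y) g @: subsp Y <= limg (pact (oper Y) h))%VS.
Proof.
move=> [f [_ fU /pact_intertwine fL]] /subvP sub.
apply/subvP => _ /memv_imgP[w + ->].
rewrite -fU => /memv_imgP[v vU ->]; rewrite -fL.
have /memv_imgP[v' _ ->] := sub _ (memv_img _ vU).
by rewrite fL memv_img ?memvf.
Qed.

(** The quadrants [k < b i], [a i < j] form a staircase, and the pairs
    [(a i, b i)] can be read off its corners. *)
Lemma comonotone_corner n (a b : 'I_n -> nat) x y :
  (forall i, 0 < b i)%N -> comonotone a b ->
  let Q k j := exists i, (k < b i)%N /\ (a i < j)%N in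
  (exists i, a i = x /\ b i = y.+1) <->
  [/\ Q y x.+1, ~ Q y.+1 x.+1 & ~ Q y x].
Proof.
move=> b0 mono Q; split=> [[i [ax byy]]|[[i [bi ai]] nb na]].
  have cmp j : (a i < a j)%N && (b i < b j)%N || (a j < a i)%N && (b j < b i)%N
               || (a j == a i) && (b j == b i).
    have [->|/mono ->//] := eqVneq i j.
    by rewrite !eqxx orbT.
  split; first by exists i; lia.
  - by move=> [j]; have := cmp j; lia.
  by move=> [j]; have := cmp j; lia.
exists i; split; apply/eqP.
  rewrite eqn_leq -ltnS ai leqNgt; apply/negP => ax; apply: na.
  by exists i.
rewrite eqn_leq bi andbT leqNgt; apply/negP => yb; apply: nb.
by exists i.
Qed.

Lemma normal_form_pairs X Y n m (a b : 'I_n -> nat) (a' b' : 'I_m -> nat) :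
  tsimilar X Y -> normal_form X a b -> normal_form Y a' b' ->
  (forall i, 0 < b i)%N -> comonotone a b ->
  (forall i, 0 < b' i)%N -> comonotone a' b' ->
  forall i, exists j, a' j = a i /\ b' j = b i.
Proof.
move=> XY [e pres uU] [e' pres' uU'] b0 mono b0' mono' i.
have Qeq k j : (exists i, (k < b i)%N /\ (a i < j)%N) <->
               (exists i, (k < b' i)%N /\ (a' i < j)%N).
  rewrite -(marked_height k j pres uU) -(marked_height k j pres' uU').
  split; apply: contra; apply: tsimilar_height => //.
  exact: tsimilar_sym.
have [y yE] : exists y, b i = y.+1 by exists (b i).-1; rewrite prednK.
have [q1 q2 q3] := (comonotone_corner (a i) y b0 mono).1
  (ex_intro _ i (conj erefl yE)).
rewrite yE; apply/(comonotone_corner _ _ b0' mono').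
by split; [apply/Qeq | move=> /Qeq | move=> /Qeq].
Qed.

End Indecomposable.

(** * Pairs encoded by subsets *)

Section Encoding.
Variables (p m : nat).
Implicit Types S : {set 'I_p}.

Definition element S (k : nat) : nat := nth 0%N [seq val x | x <- enum S] k.

(** For [#|S| = 2m + 1], the middle element of [S] is [a 0 = p - b 0]; going down
    from it one reads the numbers [a i], and going up the numbers [p - b i]. *)
Definition left_part S (i : 'I_m.+1) : nat := element S (m - i).

Definition right_part S (i : 'I_m.+1) : nat := p - element S (m + i).

Lemma sorted_elements S : sorted ltn [seq val x | x <- enum S].
Proof.
apply: (subseq_sorted ltn_trans) (iota_ltn_sorted 0 p).
by rewrite -val_enum_ord map_subseq // enumT /enum_mem filter_subseq.
Qed.

Lemma size_elements S : size [seq val x | x <- enum S] = #|S|.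
Proof. by rewrite size_map -cardE. Qed.

Lemma element_ltn S k l :
  (k < l)%N -> (l < #|S|)%N -> (element S k < element S l)%N.
Proof.
move=> kl lS; apply: (sorted_ltn_nth ltn_trans 0%N (sorted_elements S)) => //.
  by rewrite inE size_elements (ltn_trans kl).
by rewrite inE size_elements.
Qed.

Lemma element_bound S k : (k < #|S|)%N -> (element S k < p)%N.
Proof.
rewrite -size_elements => /(mem_nth 0%N)/mapP[x _ xE].
by rewrite /element xE ltn_ord.
Qed.

Lemma element_memP S (x : 'I_p) :
  x \in S <-> exists2 k, (k < #|S|)%N & element S k = x.
Proof.
rewrite -mem_enum -(mem_map val_inj); split=> [xS|[k kS xE]].
  exists (index (val x) [seq val y | y <- enum S]); last exact: nth_index.
  by rewrite -size_elements index_mem.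
by rewrite -[val x]xE mem_nth // size_elements.
Qed.

Section OddCard.
Variable S : {set 'I_p}.
Hypothesis cardS : #|S| = m.*2.+1.

Lemma right_part_gt0 i : (0 < right_part S i)%N.
Proof. by rewrite subn_gt0 element_bound // cardS; have := ltn_ord i; lia. Qed.

Lemma parts_comonotone : comonotone (left_part S) (right_part S).
Proof.
suff lt (i j : 'I_m.+1) : (i < j)%N ->
    (left_part S j < left_part S i)%N && (right_part S j < right_part S i)%N.
  by move=> i j; rewrite neq_ltn => /orP[] /lt -> //; rewrite orbT.
move=> ij; have jm := ltn_ord j; rewrite element_ltn ?cardS /=; try lia.
have : (element S (m + i) < element S (m + j))%N by apply: element_ltn; lia.
have : (element S (m + j) < p)%N by apply: element_bound; lia.
rewrite /right_part; lia.
Qed.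

Lemma parts_sum_max :
  (forall i, left_part S i + right_part S i <= p)%N /\
  exists i, (left_part S i + right_part S i)%N = p.
Proof.
have bound k : (k <= m.*2)%N -> (element S k < p)%N.
  by move=> km; apply: element_bound; rewrite cardS.
split=> [i|].
  have im := ltn_ord i; have : (element S (m + i) < p)%N by apply: bound; lia.
  rewrite /left_part /right_part; have [->|i0] := posnP i.
    by rewrite subn0 addn0; lia.
  have : (element S (m - i) < element S (m + i))%N by apply: element_ltn; lia.
  lia.
exists ord0; rewrite /left_part /right_part subn0 addn0 subnKC //.
by apply/ltnW/bound; lia.
Qed.

Lemma parts_memP (x : 'I_p) :
  x \in S <-> exists i, left_part S i = x \/ (p - right_part S i)%N = x.
Proof.
have right_element i : (p - right_part S i)%N = element S (m + i).
  by rewrite subKn // ltnW // element_bound // cardS; have := ltn_ord i; lia.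
rewrite element_memP; split=> [[k kS xE]|[i [xE|xE]]].
- have [km|mk] := leqP k m.
    have im : (m - k < m.+1)%N by lia.
    by exists (Ordinal im); left; rewrite /left_part /= subKn.
  have im : (k - m < m.+1)%N by lia.
  by exists (Ordinal im); right; rewrite right_element /= subnKC // ltnW.
- by exists (m - i)%N => //; lia.
by exists (m + i)%N; rewrite -?right_element //; have := ltn_ord i; lia.
Qed.

End OddCard.

Lemma parts_of_decreasing (a b : 'I_m.+1 -> nat) :
  (forall i j : 'I_m.+1, (i < j)%N -> (a j < a i)%N && (b j < b i)%N) ->
  (forall i, 0 < b i)%N -> (a ord0 + b ord0)%N = p ->
  exists S, [/\ #|S| = m.*2.+1, left_part S = a & right_part S = b].
Proof.
move=> dec b0 sum0.
pose t k := if (k <= m)%N then a (inord (m - k)) else (p - b (inord (k - m)))%N.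
have b_le i : (b i <= b ord0)%N.
  by have [->//|] := eqVneq i ord0; rewrite -lt0n => /(dec ord0) /andP[_ /ltnW].
have a_le i : (a i <= a ord0)%N.
  by have [->//|] := eqVneq i ord0; rewrite -lt0n => /(dec ord0) /andP[/ltnW].
have b00 := b0 ord0.
have tp k : (t k < p)%N.
  rewrite /t; case: (leqP k m) => _.
    by have := a_le (inord (m - k)); lia.
  by have := b0 (inord (k - m)); have := b_le (inord (k - m)); lia.
have inord0 : inord 0 = ord0 :> 'I_m.+1 by apply: val_inj; rewrite /= inordK.
have decN i j : (i < j)%N -> (j <= m)%N ->
    (a (inord j) < a (inord i))%N && (b (inord j) < b (inord i))%N.
  by move=> ij jm; apply: dec; rewrite !inordK //; lia.
have t_sorted : sorted ltn (mkseq t m.*2.+1).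
  apply/(sortedP 0%N) => k; rewrite size_mkseq => km.
  rewrite !nth_mkseq //; last exact: ltnW.
  rewrite /t; case: (ltngtP k m) => [lt_km|gt_km|->].
  - by have /andP[] := decN (m - k.+1)%N (m - k)%N ltac:(lia) ltac:(lia).
  - have /andP[_] := decN (k - m)%N (k.+1 - m)%N ltac:(lia) ltac:(lia).
    by have := b_le (inord (k - m)); lia.
  have /andP[_] := decN 0%N (m.+1 - m)%N ltac:(lia) ltac:(lia).
  by rewrite subnn inord0; have := b_le (inord (m.+1 - m)); lia.
pose S := [set x : 'I_p | val x \in mkseq t m.*2.+1].
have SE : [seq val x | x <- enum S] = mkseq t m.*2.+1.
  apply: (irr_sorted_eq ltn_trans ltnn (sorted_elements S) t_sorted) => k.
  apply/mapP/idP => [[x + ->]|kt]; first by rewrite mem_enum inE.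
  have kp : (k < p)%N by have /mapP[j _ ->] := kt.
  by exists (Ordinal kp); rewrite // mem_enum inE.
have elementE k : (k < m.*2.+1)%N -> element S k = t k.
  by move=> km; rewrite /element SE nth_mkseq.
exists S; split.
- by rewrite -size_elements SE size_mkseq.
- apply/funext => i; have im := ltn_ord i.
  by rewrite /left_part elementE /t ?leq_subr ?subKn ?inord_val //; lia.
apply/funext => i; have im := ltn_ord i.
rewrite /right_part elementE; last by lia.
have [->|i0] := eqVneq i ord0.
  by rewrite /t addn0 leqnn subnn inord0; lia.
rewrite -lt0n /= in i0; rewrite /t ifF; last by lia.
by rewrite addKn inord_val subKn //; have := b_le i; lia.
Qed.

End Encoding.

Lemma comonotone_sort n (a b : 'I_n -> nat) : comonotone a b ->
  exists2 s : 'I_n -> 'I_n, injective s &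
    forall i j : 'I_n, (i < j)%N ->
      (a (s j) < a (s i))%N && (b (s j) < b (s i))%N.
Proof.
move=> mono; pose r i j := (a j <= a i)%N.
have rtr : transitive r by move=> i j k; rewrite /r => ij jk; apply: leq_trans ij.
have rtot : total r by move=> i j; apply: leq_total.
have sz : size (sort r (enum 'I_n)) == n by rewrite size_sort size_enum_ord.
pose s i := tnth (Tuple sz) i.
have sinj : injective s.
  move=> i j; rewrite /s !(tnth_nth i) => /eqP; rewrite nth_uniq.
  - by move=> /eqP/val_inj.
  - by rewrite size_sort size_enum_ord.
  - by rewrite size_sort size_enum_ord.
  by rewrite sort_uniq enum_uniq.
exists s => // i j ij.
have : r (s i) (s j).
  rewrite /s !(tnth_nth i).
  by apply: (sorted_ltn_nth rtr) => //; rewrite ?inE ?(eqP sz) // sort_sorted.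
have : s i != s j by rewrite (inj_eq sinj) -val_eqE ltn_eqF.
by move=> /mono; rewrite /r; lia.
Qed.

Section Classification.
Variables (K : fieldType) (p m : nat).
Hypothesis p0 : (0 < p)%N.
Implicit Types (X : triple K) (S : {set 'I_p}).

Lemma normal_form_permute X n (a b : 'I_n -> nat) (s : 'I_n -> 'I_n) :
  injective s -> normal_form X a b -> normal_form X (a \o s) (b \o s).
Proof.
move=> sinj [e pres uU]; have [N TN] := oper_nilpotent X.
exists (e \o s).
  apply: (presents_reindex TN sinj _ pres) => i _.
  exact: (injF_onto sinj).
suff -> : marked (oper X) (a \o s) (e \o s) = marked (oper X) a e by [].
by rewrite /marked /lincomb [RHS](reindex_inj sinj).
Qed.

Lemma parts_admissible X S : #|S| = m.*2.+1 ->
  normal_form X (left_part (m := m) S) (right_part S) -> admissible p m.+1 X.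
Proof.
move=> cS nf; have b0 := right_part_gt0 cS; have mono := parts_comonotone cS.
have kerU := normal_form_nker_subsp nf b0 isT.
split=> //; first exact: normal_form_indecomposable nf b0 mono kerU.
  by apply/(normal_form_order nf p0)/parts_sum_max.
exact: normal_form_nker nf b0.
Qed.

Lemma admissible_parts X : admissible p m.+1 X ->
  exists2 S : {set 'I_p}, #|S| = m.*2.+1 &
    normal_form X (left_part (m := m) S) (right_part S).
Proof.
move=> [indec ord ker kerU].
have [n [a [b [nf b0 mono]]]] := indecomposable_normal_form indec kerU.
have := normal_form_nker nf b0; rewrite ker => nE.
case: n / nE a b nf b0 mono => a b nf b0 mono.
have [s sinj dec] := comonotone_sort mono.
have {}nf := normal_form_permute sinj nf.
have {}b0 i : (0 < (b \o s) i)%N by apply: b0.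
have [le_p [i ip]] := (normal_form_order nf p0).1 ord.
have sum0 : ((a \o s) ord0 + (b \o s) ord0)%N = p.
  have [<-//|] := eqVneq i ord0; rewrite -lt0n => /(dec ord0).
  by move: (le_p ord0) ip => /=; lia.
have [S [cS aE bE]] := parts_of_decreasing dec b0 sum0.
by exists S; rewrite ?aE ?bE.
Qed.

Lemma parts_similar_inj X Y S S' : #|S| = m.*2.+1 -> #|S'| = m.*2.+1 ->
  normal_form X (left_part (m := m) S) (right_part S) ->
  normal_form Y (left_part (m := m) S') (right_part S') ->
  tsimilar X Y -> S = S'.
Proof.
suff sub X1 Y1 S1 S2 : #|S1| = m.*2.+1 -> #|S2| = m.*2.+1 ->
    normal_form X1 (left_part (m := m) S1) (right_part S1) ->
    normal_form Y1 (left_part (m := m) S2) (right_part S2) ->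
    tsimilar X1 Y1 -> S1 \subset S2.
  move=> cS cS' nf nf' XY; apply/eqP; rewrite eqEsubset.
  rewrite (sub _ _ _ _ cS cS' nf nf' XY).
  by rewrite (sub _ _ _ _ cS' cS nf' nf (tsimilar_sym XY)).
move=> c1 c2 nf1 nf2 XY; apply/subsetP => x /(parts_memP c1)[i ix].
have [j [ja jb]] := normal_form_pairs XY nf1 nf2 (right_part_gt0 c1)
  (parts_comonotone c1) (right_part_gt0 c2) (parts_comonotone c2) i.
by apply/(parts_memP c2); exists j; rewrite ja jb.
Qed.

Lemma similarity_class_card :
  has_card (similarity_class K p m.+1) 'C(p, m.*2.+1).
Proof.
have [X nfX] := choice (fun S : {set 'I_p} => normal_form_exists K (left_part (m := m) S)
                                                    (right_part S)).
have <- : #|[set S : {set 'I_p} | #|S| == m.*2.+1]| = 'C(p, m.*2.+1).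
  by rewrite card_draws card_ord.
set D := [set S | _].
have cD (i : 'I_#|D|) : #|enum_val i| = m.*2.+1.
  by have := enum_valP i; rewrite inE => /eqP.
exists (fun i => tsimilar (X (enum_val i))) => [i j ij|C].
  apply: enum_val_inj; apply: (parts_similar_inj (cD i) (cD j) (nfX _) (nfX _)).
  rewrite ij; exact: tsimilar_refl.
split=> [[Y /admissible_parts[S cS nfS] ->]|[i <-]].
  have SD : S \in D by rewrite inE cS.
  exists (enum_rank_in SD S); rewrite enum_rankK_in //.
  apply: tsimilar_class_eq; exact: normal_form_similar (nfX S) nfS.
by exists (X (enum_val i)); first exact: (parts_admissible (cD i)).
Qed.

End Classification.

Theorem theoremA (R : realType) (p n : nat) (hp : (1 <= p)%N) (hn : (1 <= n)%N) :
  has_card (similarity_class R[i] p n) 'C(p, 2 * n - 1).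
Proof.
case: n hn => // m _; rewrite (_ : 2 * m.+1 - 1 = m.*2.+1)%N; last by lia.
exact: similarity_class_card.
Qed.
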